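(* Let $p$ be an odd prime, $n\ge 1$, and let $G=\mathrm{Hol}(C_{p^n})$, with the presentation $$G=\langle a,b \mid a^{p^n}=1,\ b^{p^{n-1}(p-1)}=1,\ b^{-1}ab=a^r\rangle,$$ where $r$ has multiplicative order $p^{n-1}(p-1)$ modulo $p^n$. With $\mathcal{O}_k$ and $\widetilde\rho_{k,\omega}$ ($0\le k\le n$) as defined in the context, the following hold. 1. $G$ has exactly $\phi(p^n)$ complex representations of degree $1$, and they are $\widetilde\rho_{0,\omega}$, where $\omega$ varies over the set of $p^{n-1}(p-1)$-th roots of unity. 2. For each $k=1,2,\dots,n$, corresponding to the orbit $\mathcal{O}_k$, $G$ has exactly $p^{n-k}$ irreducible complex representations, of degree $\phi(p^k)$, and they are $\widetilde\rho_{k,\omega}$, where $\omega$ varies over the set of $p^{n-k}$-th roots of unity. 3. $G$ has exactly $(1+p+\cdots+p^n)-p^{n-1}$ inequivalent irreducible complex representations. 4. Corresponding to the orbit $\mathcal{O}_n$ there is only one irreducible complex representation, which has degree $\phi(p^n)$; it is the unique faithful irreducible complex representation of $G$.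
   Context: $C_{m}$ is the cyclic group of order $m$; $\mathrm{Hol}(C_m)$ (the holomorph) is the semidirect product $C_m\rtimes\mathrm{Aut}(C_m)$ for the natural action; $\phi$ is Euler's function. Representations are counted up to equivalence. Let $N=\langle a\rangle$, let $\zeta$ be a primitive $p^n$-th root of unity, and let $\widehat N=\{\widetilde\chi_i: 0\le i\le p^n-1\}$ be the set of irreducible complex representations of $N$, where $\widetilde\chi_i(a)=\zeta^i$. $G$ acts on $\widehat N$ by $\chi^g(x)=\chi(g^{-1}xg)$. $\mathcal{O}_0$ denotes the orbit of $\widetilde\chi_0$, and for $1\le k\le n$, $\mathcal{O}_k$ denotes the orbit of $\widetilde\chi_{p^{n-k}}$; these are all the orbits. The irreducible representations of $G$ corresponding to an orbit $\mathcal{O}$ are those obtained by the Wigner–Mackey method of little groups: choose $\chi\in\mathcal{O}$, let $I_\chi$ be its stabilizer in $G$ and $H_\chi=I_\chi\cap\langle b\rangle$, so $I_\chi=N\rtimes H_\chi$; extend $\chi$ to $I_\chi$ trivially on $H_\chi$; for each irreducible complex representation $\rho$ of $H_\chi$, regarded as a representation of $I_\chi$ via $I_\chi\to H_\chi$, take the representation of $G$ induced from $\chi\otimes\rho$. For a $p^{n-1}(p-1)$-th root of unity $\omega$, $\widetilde\rho_{0,\omega}$ is the degree $1$ representation $a\mapsto 1$, $b\mapsto\omega$. For $1\le k\le n$ and a $p^{n-k}$-th root of unity $\omega$, $\widetilde\rho_{k,\omega}$ is the representation of degree $\phi(p^k)$ on a space with basis $e_0,\dots,e_{\phi(p^k)-1}$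 given by $\widetilde\rho_{k,\omega}(a)e_j=\zeta^{r^jp^{n-k}}e_j$ for all $j$, and $\widetilde\rho_{k,\omega}(b)e_j=e_{j+1}$ for $0\le j<\phi(p^k)-1$, $\widetilde\rho_{k,\omega}(b)e_{\phi(p^k)-1}=\omega e_0$. *)

(* Defs.v *)
From mathcomp Require Import all_boot all_order all_algebra.
From mathcomp Require Import all_fingroup all_solvable all_field all_character.
From mathcomp Require Import complex reals.

Set Implicit Arguments.
Unset Strict Implicit.
Unset Printing Implicit Defensive.

Import GroupScope GRing.Theory.
Local Open Scope ring_scope.

(* The external semidirect product A ><| Aut A for the natural action. *)
Definition Hol (aT : finGroupType) (A : {group aT}) :
    {set sdprod_groupType [Aut A]} :=
  [set: sdprod_groupType [Aut A]].

Section Counting.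

Variables (F : fieldType) (gT : finGroupType) (G : {group gT}).
Implicit Type P : representation F G -> Prop.

Definition exactly (m : nat) P : Prop :=
  exists s : 'I_m -> representation F G,
    [/\ forall i, P (s i),
        forall i j, mx_rsim (s i) (s j) -> i = j
      & forall V, P V -> exists i, mx_rsim V (s i)].

Definition they_are (I : Type) P (D : I -> Prop)
    (f : I -> representation F G) : Prop :=
  (forall w, D w -> P (f w))
  /\ (forall V, P V -> exists2 w, D w & mx_rsim V (f w)).

End Counting.

(* Linear representations of N are used throughout as elements of the dual of
   N: in degree 1, equivalence is equality of the values on N. *)
Section LittleGroups.

Variables (F : fieldType) (gT : finGroupType).

(* psi = chi ^ g for some g in G, where (chi ^ g) x = chi (g^-1 x g); recall
   that x ^ g is g^-1 * x * g. *)
Definition conj_orbit (G N : {group gT}) (chi psi : mx_representation F N 1) :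
    Prop :=
  exists2 g, g \in G & {in N, forall x, psi x = chi (x ^ g)%g}.

(* As for the inertia group of a class function, g is taken in the normaliser
   of N, so that this is a group for every N; here N will be normal in G. *)
Definition stab (G N : {group gT}) (chi : mx_representation F N 1) :
    {set gT} :=
  [set g in 'N_G(N)%g | [forall x in N, chi (x ^ g)%g == chi x]].

Lemma stab_group_set (G N : {group gT}) (chi : mx_representation F N 1) :
  group_set (stab G chi).
Proof.
apply/group_setP; split=> [|g h].
  by rewrite inE group1; apply/forall_inP=> x _; rewrite conjg1.
rewrite !inE => /andP[Ng /forall_inP chi_g] /andP[Nh /forall_inP chi_h].
have := groupM (G := 'N_G(N)%G) (x := g) (y := h).
rewrite !inE Ng Nh => -> //; apply/forall_inP=> x Nx.
have /andP[_ nNg] := Ng.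
have Nxg : (x ^ g)%g \in N by rewrite memJ_norm // inE.
by rewrite conjgM (eqP (chi_h _ Nxg)) chi_g.
Qed.

Canonical stab_group (G N : {group gT}) (chi : mx_representation F N 1) :=
  Group (stab_group_set G chi).

(* sigma is induced from tau: the space of sigma has an H-stable subspace W
   (spanned by the rows of the matrix W) which affords tau, and it is the
   direct sum of the translates of W indexed by H \ G.  Matrices act on row
   vectors on the right, hence the right cosets. *)
Definition is_induced (H G : {group gT}) (m d : nat)
    (tau : mx_representation F H m) (sigma : mx_representation F G d) : Prop :=
  exists W : 'M[F]_(m, d),
    [/\ row_free W,
        {in H, forall h, W *m sigma h = tau h *m W},
        mxdirect (\sum_(C in rcosets H G) <<W *m sigma (repr C)>>)%MS
      & row_full (\sum_(C in rcosets H G) <<W *m sigma (repr C)>>)%MS].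

(* V is obtained from chi by the little group method for G = N ><| B.  With
   I = stab G chi = N ><| H, H = I :&: B, the tensor product of chi (extended
   trivially on H) and rho (inflated along I -> H) is the representation tau
   of I with tau (x h) = chi(x) rho(h), for x in N and h in H. *)
Definition little_group (G N B : {group gT}) (chi : mx_representation F N 1)
    (V : representation F G) : Prop :=
  exists (m : nat)
         (rho : mx_representation F (stab_group G chi :&: B)%G m)
         (tau : mx_representation F (stab_group G chi) m),
    [/\ mx_irreducible rho,
        {in N & stab G chi :&: B,
           forall x h, tau (x * h)%g = chi x 0 0 *: rho h}
      & is_induced tau V].

End LittleGroups.

Section Rho.

Variables (F : fieldType) (p n r : nat) (zeta : F).

(* The matrices of a and b in the basis e_0, e_1, ... of rho_(k, w); column j
   holds the coordinates of the image of e_j. *)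
Definition rho_a (k : nat) : 'M[F]_(totient (p ^ k)) :=
  \matrix_(i, j) if i == j then zeta ^+ (r ^ j * p ^ (n - k)) else 0.

Definition rho_b (k : nat) (w : F) : 'M[F]_(totient (p ^ k)) :=
  \matrix_(i, j)
    if (j.+1 < totient (p ^ k))%N then (i == j.+1 :> nat)%:R
    else if i == 0 :> nat then w else 0.

End Rho.

(* Main.v *)
(* An irreducible representation V of G contains an eigenvector of a, with
   eigenvalue zeta^(u p^(n-k)) for some u prime to p; since r generates the
   units modulo p^n, the conjugates of this eigenvalue under b are exactly
   phi(p^k) in number, and b^phi(p^k) acts on the eigenspace.  An eigenvector
   of b^phi(p^k) in it, of eigenvalue w, generates an image of rho_(k,w), which
   is irreducible because rho_(k,w)(a) has distinct eigenvalues permuted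
   transitively by b; hence V is rho_(k,w).  The same argument identifies the
   representations produced by the little group method, whose inertia group is
   generated by a and b^phi(p^k).  Degrees separate different k, and the scalar
   by which b^phi(p^k) acts separates different w. *)
Require Import Defs.
From mathcomp Require Import all_boot all_order all_algebra.
From mathcomp Require Import all_fingroup all_solvable all_field all_character.
From mathcomp Require Import complex reals.

Set Implicit Arguments.
Unset Strict Implicit.
Unset Printing Implicit Defensive.

Import GroupScope GRing.Theory.
Local Open Scope ring_scope.

(** * Primitive roots modulo prime powers *)

Lemma eqn_mod_natr_Zp (m i j : nat) :
  (1 < m)%N -> (i%:R == j%:R :> 'Z_m) = (i == j %[mod m]).
Proof. by move=> m_gt1; rewrite -val_eqE /= !val_Zp_nat. Qed.

Lemma eqn_exp_mod_root (m e r i j : nat) :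
  (1 < m)%N -> e.-primitive_root (r%:R : 'Z_m) ->
  (r ^ i == r ^ j %[mod m]) = (i == j %[mod e]).
Proof.
move=> m_gt1 r_prim.
by rewrite -eqn_mod_natr_Zp // !natrX (eq_prim_root_expr r_prim).
Qed.

Lemma coprime_totient_root (m r : nat) :
  (1 < m)%N -> (totient m).-primitive_root (r%:R : 'Z_m) -> coprime m r.
Proof.
move=> m_gt1 r_prim.
have /eqP/(congr1 (coprime m)) : r ^ totient m == 1 %[mod m].
  by rewrite -(expn0 r) (eqn_exp_mod_root _ _ m_gt1 r_prim) modnn mod0n.
by rewrite !coprime_modr coprimen1 coprime_pexpr ?totient_gt0 ?(ltnW m_gt1).
Qed.

(** A counting argument: the residues of [r ^ i] for [i < totient m] are distinct and coprime to
    [m], and there are only [totient m] such residues, so every one of them occurs. *)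
Lemma exp_totient_root_surj (m r u : nat) :
  (1 < m)%N -> (totient m).-primitive_root (r%:R : 'Z_m) -> coprime m u ->
  exists i, r ^ i = u %[mod m].
Proof.
move=> m_gt1 r_prim co_u.
have m_gt0 := ltnW m_gt1.
have co_r := coprime_totient_root m_gt1 r_prim.
pose s1 := [seq (r ^ i %% m)%N | i <- iota 0 (totient m)].
pose s2 := [seq d <- index_iota 0 m | coprime m d].
have uniq_s1 : uniq s1.
  rewrite map_inj_in_uniq ?iota_uniq // => i j.
  rewrite !mem_iota !add0n => /= lt_i lt_j /eqP.
  by rewrite (eqn_exp_mod_root _ _ m_gt1 r_prim) !modn_small // => /eqP.
have sub_s12 : {subset s1 <= s2}.
  move=> _ /mapP[i _ ->].
  by rewrite mem_filter coprime_modr mem_index_iota ltn_mod m_gt0 coprimeXr.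
have sz_s2 : (size s2 <= size s1)%N.
  rewrite size_map size_iota totient_count_coprime size_filter -sum1_count.
  rewrite [leqRHS]big_mkcond [leqLHS]big_mkcond /=.
  by apply: leq_sum => i _; case: coprime.
have [_ /(_ (u %% m)%N)] := uniq_min_size uniq_s1 sub_s12 sz_s2.
rewrite mem_filter coprime_modr co_u mem_index_iota ltn_mod m_gt0 /=.
by case/mapP=> i _ ->; exists i.
Qed.

Section RootModPrimePower.

Variables p n r : nat.
Hypotheses (p_prime : prime p) (n_gt0 : (0 < n)%N).
Hypothesis r_prim : (totient (p ^ n)).-primitive_root (r%:R : 'Z_(p ^ n)).

Let pn_gt1 : (1 < p ^ n)%N.
Proof. by rewrite -(exp1n n) ltn_exp2r // prime_gt1. Qed.

Lemma coprime_root_base : coprime p r.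
Proof. by have := coprime_totient_root pn_gt1 r_prim; rewrite coprime_pexpl. Qed.

(** A generator of the units modulo [p ^ n] stays a generator modulo [p ^ k], since units lift along
    the reduction. So [r] has order exactly [totient (p ^ k)] there, which is what makes the orbit
    of index [k] have [totient (p ^ k)] elements. *)
Lemma dvdn_totient_root k j : (k <= n)%N ->
  (totient (p ^ k) %| j)%N = (r ^ j == 1 %[mod p ^ k]).
Proof.
move=> le_kn; have [->|k_gt0] := posnP k; first by rewrite !modn1 dvd1n.
have pk_gt0 : (0 < p ^ k)%N by rewrite expn_gt0 prime_gt0.
have co_rk : coprime r (p ^ k) by rewrite coprime_sym coprime_pexpl ?coprime_root_base.
have tot1 : r ^ totient (p ^ k) = 1 %[mod p ^ k] by exact: Euler_exp_totient.
(* Stated for any period [d]: it is used both with the Euler exponent and with a hypothetical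
   smaller period. *)
have modE d i : r ^ d = 1 %[mod p ^ k] -> r ^ i = r ^ (i %% d) %[mod p ^ k].
  move=> rd1; rewrite {1}(divn_eq i d) (mulnC _ d) expnD expnM -modnMml.
  by rewrite -modnXm rd1 modnXm exp1n modnMml mul1n.
rewrite /dvdn; have [j0|j_gt0] := posnP (j %% totient (p ^ k)).
  by rewrite (modE _ _ tot1) j0 eqxx.
rewrite (modE _ _ tot1); apply/esym/negbTE/negP=> /eqP.
set d := (j %% _)%N in j_gt0 * => rd1.
suff : (totient (p ^ k) <= d)%N by rewrite leqNgt ltn_mod totient_gt0 pk_gt0.
(* The powers of r exhaust the units, and repeat with period d. *)
rewrite totient_count_coprime -[leqRHS](size_iota 0).
rewrite -(size_map (fun i => r ^ i %% p ^ k)%N).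
rewrite (eq_bigr (fun i : nat => if coprime i (p ^ k) then 1 else 0)%N); last first.
  by move=> i _; rewrite coprime_sym; case: coprime.
rewrite -big_mkcond sum1_count -size_filter uniq_leq_size ?filter_uniq ?iota_uniq //.
move=> u; rewrite mem_filter mem_index_iota => /andP[co_u lt_u].
have [|i Di] := exp_totient_root_surj pn_gt1 r_prim (u := u).
  by rewrite coprime_pexpl // -(coprime_pexpl _ _ k_gt0) coprime_sym.
apply/mapP; exists (i %% d)%N; first by rewrite mem_iota ltn_mod.
rewrite -(modE _ _ rd1) -[LHS](modn_small lt_u).
by rewrite -(modn_dvdm _ (dvdn_exp2l p le_kn)) -Di modn_dvdm ?dvdn_exp2l.
Qed.

(** For [i <= j], the difference factors as [r ^ i * (r ^ (j - i) - 1)], and the unit [r ^ i]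
    cancels modulo [p ^ k]. *)
Lemma eqn_exp_mod_pfactor k i j : (k <= n)%N ->
  (r ^ i == r ^ j %[mod p ^ k]) = (i == j %[mod totient (p ^ k)]).
Proof.
move=> le_kn; wlog le_ij: i j / (i <= j)%N.
  move=> IH; have [/IH //|/ltnW/IH E] := leqP i j.
  by rewrite eq_sym E eq_sym.
have r_gt0 : (0 < r)%N.
  case: (posnP r) coprime_root_base => // ->; rewrite /coprime gcdn0 => /eqP p1.
  by move: (prime_gt1 p_prime); rewrite p1.
rewrite [LHS]eq_sym [RHS]eq_sym !eqn_mod_dvd ?leq_pexp2l //.
rewrite dvdn_totient_root // eqn_mod_dvd ?expn_gt0 ?r_gt0 //.
have -> : (r ^ j - r ^ i)%N = (r ^ i * (r ^ (j - i) - 1))%N.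
  by rewrite mulnBr muln1 -expnD subnKC.
rewrite Gauss_dvdr // coprime_sym; have [->|k_gt0] := posnP k; first exact: coprimen1.
by rewrite coprime_pexpr // coprime_sym coprimeXr // coprime_root_base.
Qed.

Lemma exp_root_surj k u : (k <= n)%N -> coprime p u ->
  exists i, r ^ i = u %[mod p ^ k].
Proof.
move=> le_kn co_u; have [|i Di] := exp_totient_root_surj pn_gt1 r_prim (u := u).
  by rewrite coprime_pexpl.
exists i; have dvd_k := dvdn_exp2l p le_kn.
by rewrite -(modn_dvdm _ dvd_k) Di modn_dvdm.
Qed.

End RootModPrimePower.

(** Euler's function is strictly increasing on the powers of an odd prime; for [p = 2] the exponents
    0 and 1 would collide. This is how degrees separate the orbits. *)
Lemma totient_pfactor_inj p k l :
  prime p -> odd p -> totient (p ^ k) = totient (p ^ l) -> k = l.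
Proof.
move=> p_prime p_odd.
suff lt_tot i j : (i < j)%N -> (totient (p ^ i) < totient (p ^ j))%N.
  move=> E; case: (ltngtP k l) => // /lt_tot; rewrite E ltnn //.
have p_gt2 : (2 < p)%N by rewrite odd_prime_gt2.
case: j => // j; rewrite ltnS => le_ij; rewrite [ltnRHS]totient_pfactor //.
have p1_gt0 : (1 < p.-1)%N by rewrite -subn1 ltn_subRL.
case: i le_ij => [|i] le_ij.
  by rewrite (leq_trans p1_gt0) // leq_pmulr // expn_gt0 prime_gt0.
by rewrite totient_pfactor // ltn_pmul2l ?ltn_exp2l ?prime_gt1 // ltnW.
Qed.

(** In characteristic 0 the polynomial ['X^m - 1] is separable, so it has [m] distinct roots, and
    such a set of roots of unity contains a primitive one. *)
Lemma closed_field_prim_root (F : numClosedFieldType) m :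
  (0 < m)%N -> {z : F | m.-primitive_root z}.
Proof.
move=> m_gt0; have [s Ds] := closed_field_poly_normal ('X^m - 1 : {poly F}).
move: Ds; rewrite lead_coefXnsubC // scale1r => Ds.
have uniq_s : uniq s.
  by rewrite -separable_prod_XsubC -Ds separable_Xn_sub_1 // Num.Theory.pnatr_eq0 -lt0n.
have sz_s : size s = m.
  by have := size_prod_XsubC s id; rewrite -Ds size_XnsubC // => -[].
have root_s : all m.-unity_root s.
  apply/allP=> z sz; rewrite unity_rootE.
  have : root ('X^m - 1) z by rewrite Ds root_prod_XsubC.
  by rewrite rootE !hornerE subr_eq0.
have /hasP/sig2W[z _ z_prim] := has_prim_root m_gt0 root_s uniq_s (eq_leq (esym sz_s)).
by exists z.
Qed.

(** * The holomorph and its matrix representations *)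

Lemma card_Hol_Zp m : (0 < m)%N -> #|Hol (Zp m)| = (m * totient m)%N.
Proof.
move=> m_gt0; have := sdprod_card (sdprod_sdpair [Aut Zp m]).
rewrite card_injm ?injm_sdpair1 // card_injm ?injm_sdpair2 // => <-.
rewrite card_Aut_cyclic ?card_Zp //; apply/cyclicP.
(* For [m = 1] the type ['Z_m] still has two elements while [Zp m] is trivial, hence the separate
   case. *)
have [m1|m_gt1] := leqP m 1.
  by exists 1%g; rewrite /= /Zp ltnNge m1 cycle1.
by exists Zp1; rewrite /= /Zp m_gt1 Zp_cycle.
Qed.

Section Metacyclic.

Variables (gT : finGroupType) (G : {group gT}) (a b : gT) (m e r : nat).
Hypotheses (m_gt0 : (0 < m)%N) (e_gt0 : (0 < e)%N).
Hypothesis G_gen : G :=: <<[set a; b]>>.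
Hypothesis cardG : #|G| = (m * e)%N.
Hypotheses (a_rel : (a ^+ m = 1)%g) (b_rel : (b ^+ e = 1)%g).
Hypothesis ab_rel : (b^-1 * a * b = a ^+ r)%g.

Lemma conjg_expgn i j : ((a ^+ i) ^ (b ^+ j) = a ^+ (i * r ^ j))%g.
Proof.
elim: j => [|j IHj]; first by rewrite conjg1 muln1.
rewrite expgSr conjgM IHj conjXg conjgE mulgA ab_rel -expgM.
by rewrite expnS mulnCA.
Qed.

Lemma metacyclic_mul : (<[b]> * <[a]>)%g = G.
Proof.
have nab : <[b]>%g \subset 'N(<[a]>)%g.
  by rewrite cycle_subG inE -cycleJ cycle_subG conjgE mulgA ab_rel mem_cycle.
by rewrite G_gen setUC -(norm_joinEl nab) joing_idl joing_idr.
Qed.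

(** The relations bound the two orders by [m] and [e]; the product formula for [<[b]> * <[a]>] and
    the order of [G] force equality and a trivial intersection. The relations and the order of [G]
    thus do the work of the presentation. *)
Lemma metacyclic_orders : [/\ #[a]%g = m, #[b]%g = e & (<[b]> :&: <[a]> = 1)%g].
Proof.
have := mul_cardG <[b]>%G <[a]>%G; rewrite /= metacyclic_mul cardG -!orderE.
have le_am : (#[a]%g <= m)%N by rewrite dvdn_leq // order_dvdn a_rel.
have le_be : (#[b]%g <= e)%N by rewrite dvdn_leq // order_dvdn b_rel.
have I_gt0 := cardG_gt0 (<[b]> :&: <[a]>)%G.
move=> /= E; have /eqP I1 : #|<[b]> :&: <[a]>|%g == 1%N.
  have : (m * e * #|<[b]> :&: <[a]>|%g <= m * e * 1)%N.
    by rewrite -E muln1 mulnC leq_mul.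
  by rewrite leq_pmul2l ?muln_gt0 ?m_gt0 // eqn_leq I_gt0 => ->.
move: E; rewrite I1 muln1 => E.
have am : #[a]%g = m.
  apply/eqP; rewrite eqn_leq le_am -(leq_pmul2r e_gt0) -E mulnC.
  by rewrite leq_mul2l le_be orbT.
split=> //; last by apply/eqP; rewrite trivg_card1 I1.
by apply/eqP; rewrite -(eqn_pmul2r m_gt0) -{1}am E mulnC.
Qed.

End Metacyclic.

Lemma repr_mx_exp (F : fieldType) (gT : finGroupType) (G : {group gT}) (d : nat)
    (rG : mx_representation F G d) g k :
  g \in G -> rG (g ^+ k)%g = rG g ^+ k.
Proof.
move=> Gg; elim: k => [|k IHk]; first by rewrite repr_mx1.
by rewrite expgS exprS repr_mxM ?groupX // IHk.
Qed.

Lemma repr_mx_eigenX (F : fieldType) (gT : finGroupType) (G : {group gT}) (d m : nat)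
    (rG : mx_representation F G d) (v : 'M_(m, d)) g c k :
  g \in G -> v *m rG g = c *: v -> v *m rG (g ^+ k)%g = c ^+ k *: v.
Proof.
move=> Gg vg; elim: k => [|k IHk]; first by rewrite repr_mx1 mulmx1 scale1r.
by rewrite expgS repr_mxM ?groupX // mulmxA vg -scalemxAl IHk scalerA -exprS.
Qed.

Lemma scale_fixed (F : fieldType) (V : lmodType F) (v : V) c :
  v != 0 -> c *: v = v -> c = 1.
Proof.
move=> nzv cv; apply/eqP; rewrite -subr_eq0; apply: contraNT nzv => nzc.
by rewrite -(inj_eq (scalerI nzc)) scaler0 scalerBl cv scale1r subrr.
Qed.

Lemma exprM_conj (R : pzRingType) (A B : R) r i j :
  A * B = B * A ^+ r -> A ^+ i * B ^+ j = B ^+ j * A ^+ (i * r ^ j).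
Proof.
move=> AB; have AXB k : A ^+ k * B = B * A ^+ (k * r).
  elim: k => [|k IHk]; first by rewrite !expr0 mul1r mulr1.
  by rewrite exprS -mulrA IHk mulrA AB -mulrA -exprD mulSn.
elim: j => [|j IHj]; first by rewrite !expr0 mulr1 mul1r muln1.
by rewrite exprSr mulrA IHj -!mulrA AXB -mulnA -expnSr.
Qed.

(** The universal property of the presentation, for matrices: each element has a normal form
    [b ^+ j * a ^+ i], unique up to the orders of [a] and [b], so matrices obeying the relations
    define a representation through normal forms. *)
Lemma metacyclic_repr (F : fieldType) (gT : finGroupType) (G : {group gT})
    (a b : gT) (r d : nat) (A B : 'M[F]_d) :
  (<[b]> * <[a]>)%g = G -> (<[b]> :&: <[a]>)%g = 1%g ->
  (b^-1 * a * b = a ^+ r)%g ->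
  A ^+ #[a]%g = 1 -> B ^+ #[b]%g = 1 -> A * B = B * A ^+ r ->
  {rho : mx_representation F G d | rho a = A /\ rho b = B}.
Proof.
move=> defG tiG ab_rel A1 B1 AB.
pose f (g : gT) : 'M[F]_d :=
  if [pick ij : 'I_#[a]%g * 'I_#[b]%g | g == b ^+ ij.2 * a ^+ ij.1]%g is Some ij
  then B ^+ ij.2 * A ^+ ij.1 else 0.
have fE i j : f (b ^+ j * a ^+ i)%g = B ^+ j * A ^+ i.
  rewrite /f; case: pickP => [[i' j'] /= /eqP E|]; last first.
    have ltm (x : gT) k : (k %% #[x]%g < #[x]%g)%N by rewrite ltn_mod order_gt0.
    move/(_ (Ordinal (ltm a i), Ordinal (ltm b j))) => /=.
    by rewrite !expg_mod_order eqxx.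
  (* Two normal forms of one element differ by an element of both cycles, hence by the identity. *)
  have Ib : (b ^- j' * b ^+ j = a ^+ i' * a ^- i)%g.
    by apply: (mulgI (b ^+ j')%g); rewrite mulKVg mulgA -E mulgK.
  have : (b ^- j' * b ^+ j)%g \in (<[b]> :&: <[a]>)%g.
    by rewrite inE {2}Ib !groupM ?groupV ?mem_cycle.
  rewrite tiG => /set1P Eb; move: Ib; rewrite Eb => /esym/eqP.
  rewrite -eq_mulgV1 eq_expg_mod_order => /eqP Ei; move/eqP: Eb.
  rewrite -eq_mulVg1 eq_expg_mod_order => /eqP Ej.
  by rewrite -(expr_mod i' A1) -(expr_mod j' B1) Ei Ej !expr_mod.
have f_repr : mx_repr G f.
  split=> [|g h]; first by have := fE 0 0; rewrite !expg0 mulg1 !expr0 mulr1.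
  rewrite -defG => /mulsgP[_ _ /cycleP[j ->] /cycleP[i ->] ->].
  move=> /mulsgP[_ _ /cycleP[j' ->] /cycleP[i' ->] ->].
  have -> : (b ^+ j * a ^+ i * (b ^+ j' * a ^+ i') =
             b ^+ (j + j') * a ^+ (i * r ^ j' + i'))%g.
    rewrite !expgD -mulgA [(a ^+ i * _)%g]mulgA [(a ^+ i * _)%g]conjgC.
    by rewrite (conjg_expgn ab_rel) !mulgA.
  rewrite !fE mulmxE !exprD -!mulrA; congr (_ * _).
  by rewrite [RHS]mulrA (exprM_conj _ _ AB) mulrA.
exists (MxRepresentation f_repr); rewrite /=; split.
  by have := fE 1 0; rewrite expg0 expg1 mul1g expr0 expr1 mul1r.
by have := fE 0 1; rewrite expg0 expg1 mulg1 expr0 expr1 mulr1.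
Qed.

(** * The matrices of rho *)

Section RhoMatrices.

Variables (F : fieldType) (p n r k : nat) (zeta w : F).
Hypotheses (p_prime : prime p) (n_gt0 : (0 < n)%N) (le_kn : (k <= n)%N).
Hypothesis r_prim : (totient (p ^ n)).-primitive_root (r%:R : 'Z_(p ^ n)).
Hypothesis zeta_prim : (p ^ n).-primitive_root zeta.

Local Notation d := (totient (p ^ k)).
Local Notation A := (rho_a p n r zeta k).
Local Notation B := (rho_b p k w).

(** [zeta ^+ (p ^ (n - k))] is a primitive root of unity of order [p ^ k]. *)
Lemma eq_zeta_expr x y :
  (zeta ^+ (x * p ^ (n - k)) == zeta ^+ (y * p ^ (n - k))) = (x == y %[mod p ^ k]).
Proof.
rewrite (eq_prim_root_expr zeta_prim).
have -> : (p ^ n = p ^ k * p ^ (n - k))%N by rewrite -expnD subnKC.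
by rewrite -!muln_modl eqn_pmul2r // expn_gt0 prime_gt0.
Qed.

Lemma eq_zeta_root_expr i j :
  (zeta ^+ (r ^ i * p ^ (n - k)) == zeta ^+ (r ^ j * p ^ (n - k)))
  = (i == j %[mod d]).
Proof. by rewrite eq_zeta_expr (eqn_exp_mod_pfactor p_prime n_gt0 r_prim). Qed.

Lemma rho_a_exp m i j :
  (A ^+ m) i j = if i == j then zeta ^+ (r ^ j * p ^ (n - k) * m) else 0.
Proof.
elim: m i j => [|m IHm] i j; first by rewrite !mxE muln0; case: eqP.
rewrite exprS mxE (bigD1 i) //= big1 => [|l /negPf i'l]; last first.
  by rewrite mxE eq_sym i'l mul0r.
rewrite mxE eqxx IHm addr0; case: eqP => [->|_]; last by rewrite mulr0.
by rewrite -exprD mulnS.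
Qed.

Lemma rho_a_order : A ^+ (p ^ n) = 1.
Proof.
apply/matrixP=> i j; rewrite rho_a_exp mxE; case: eqP => // _.
by rewrite mulnC exprM (prim_expr_order zeta_prim) expr1n.
Qed.

Lemma rho_ab_rel : A * B = B * A ^+ r.
Proof.
apply/matrixP=> i j; rewrite !mxE (bigD1 i) //= big1 => [|l /negPf i'l]; last first.
  by rewrite mxE eq_sym i'l mul0r.
rewrite (bigD1 j) //= big1 => [|l /negPf i'l]; last by rewrite rho_a_exp i'l mulr0.
rewrite rho_a_exp !addr0 eqxx mulrC [A i i]mxE eqxx.
have -> : (r ^ j * p ^ (n - k) * r = r ^ j.+1 * p ^ (n - k))%N.
  by rewrite mulnAC -expnSr.
rewrite mxE; case: ltnP => [lt_j|ge_j].
  by case: eqP => [->|_]; rewrite // !mul0r.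
case: eqP => [i0|_]; last by rewrite !mul0r.
(* In the last column the relation wraps around from index [d] to index 0; it closes up because
   [r ^ d] is 1 modulo [p ^ k]. *)
congr (_ * _); apply/eqP; rewrite eq_zeta_root_expr.
have -> : j.+1 = d by apply/eqP; rewrite eqn_leq ge_j ltn_ord.
by rewrite i0 modnn mod0n.
Qed.

(* Matrices act on rows on the right, so b lowers the index of basis_row. *)
Definition basis_row j : 'rV[F]_d := \row_l (l == j :> nat)%:R.
Local Notation D := basis_row.

Lemma basis_rowE (i : 'I_d) : D i = delta_mx 0 i.
Proof. by apply/rowP=> l; rewrite !mxE eqxx. Qed.

Lemma basis_row_full m (U : 'M_(m, d)) :
  (forall j, (j < d)%N -> (D j <= U)%MS) -> row_full U.
Proof.
move=> DU; rewrite -sub1mx; apply/row_subP=> i.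
by rewrite row1 -basis_rowE DU.
Qed.

Lemma basis_row_mulmx_inj m (M N : 'M_(d, m)) :
  (forall j, (j < d)%N -> D j *m M = D j *m N) -> M = N.
Proof. by move=> E; apply/row_matrixP=> i; rewrite !rowE -basis_rowE E. Qed.

Lemma basis_row_a j : D j *m A = zeta ^+ (r ^ j * p ^ (n - k)) *: D j.
Proof.
apply/rowP=> l; rewrite !mxE (bigD1 l) //= big1 => [|i /negPf l'i]; last first.
  by rewrite !mxE l'i mulr0.
by rewrite !mxE eqxx addr0 mulrC; case: eqP => [->|]; rewrite ?mulr0.
Qed.

Lemma basis_row_bS j : (j.+1 < d)%N -> D j.+1 *m B = D j.
Proof.
move=> lt_j; rewrite -[j.+1]/(nat_of_ord (Ordinal lt_j)) basis_rowE -rowE.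
apply/rowP=> l; rewrite !mxE /= eqSS eq_sym; case: ltnP => // le_dl.
by case: eqP => // E; move: lt_j; rewrite -E ltnNge le_dl.
Qed.

Lemma basis_row_b0 : D 0 *m B = w *: D d.-1.
Proof.
have d_gt0 : (0 < d)%N by rewrite totient_gt0 expn_gt0 prime_gt0.
rewrite -[0%N]/(nat_of_ord (Ordinal d_gt0)) basis_rowE -rowE.
apply/rowP=> l; rewrite !mxE /=; case: ltnP => [lt_l|le_dl].
  by case: eqP => [El|_]; rewrite ?mulr0 //; move: lt_l; rewrite El prednK ?ltnn.
have -> : (l == d.-1 :> nat) by rewrite eqn_leq -ltnS prednK // ltn_ord -ltnS prednK.
by rewrite mulr1.
Qed.

Lemma basis_row_bX j m : (m <= j < d)%N -> D j *m B ^+ m = D (j - m).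
Proof.
elim: m => [|m IHm] /andP[le_mj lt_jd]; first by rewrite expr0 mulmx1 subn0.
rewrite exprSr -mulmxE mulmxA IHm ?lt_jd 1?ltnW // subnS.
have : (0 < j - m)%N by rewrite subn_gt0.
case E: (j - m)%N => [|i] // _; apply: basis_row_bS.
by rewrite -E (leq_ltn_trans _ lt_jd) ?leq_subr.
Qed.

Lemma rho_b_exp : B ^+ d = w%:M.
Proof.
apply: basis_row_mulmx_inj => j lt_j; rewrite mul_mx_scalar.
have d_gt0 : (0 < d)%N by apply: leq_ltn_trans lt_j.
have le_jd : (j <= d.-1)%N by rewrite -ltnS prednK.
(* One full turn: [j] steps down to index 0, one wrapping step that contributes [w], then down from
   [d.-1] back to [j]. *)
suff Bexp e : e = (j + (1 + (d.-1 - j)))%N -> D j *m B ^+ e = w *: D j.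
  by apply: Bexp; rewrite addnCA subnKC // add1n prednK.
move=> ->; rewrite exprD -mulmxE mulmxA basis_row_bX ?leqnn // subnn exprD expr1.
rewrite -mulmxE mulmxA basis_row_b0 -scalemxAl basis_row_bX ?subKn //.
by rewrite leq_subr prednK /=.
Qed.

Lemma basis_row_orbit i j : (i < d)%N -> (j < d)%N -> w != 0 ->
  exists m c, c != 0 /\ D i *m B ^+ m = c *: D j.
Proof.
move=> lt_i lt_j nzw; have [le_ji|lt_ij] := leqP j i.
  exists (i - j)%N, 1; rewrite oner_eq0 scale1r basis_row_bX ?subKn //.
  by rewrite leq_subr lt_i.
have d_gt0 : (0 < d)%N by apply: leq_ltn_trans lt_j.
have le_jd : (j <= d.-1)%N by rewrite -ltnS prednK.
(* To go up from [i] to [j], descend to 0, wrap once with factor [w], then descend from [d.-1]. *)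
exists (i + (1 + (d.-1 - j)))%N, w; split=> //.
rewrite exprD -mulmxE mulmxA basis_row_bX ?leqnn // subnn exprD expr1.
rewrite -mulmxE mulmxA basis_row_b0 -scalemxAl basis_row_bX ?subKn //.
by rewrite leq_subr prednK /=.
Qed.

End RhoMatrices.

(** * Common eigenvectors and intertwining matrices *)

Lemma abelian_eigenvector (F : closedFieldType) (gT : finGroupType)
    (H : {group gT}) (d : nat) (rH : mx_representation F H d) (U : 'M_d) :
  abelian H -> mxmodule rH U -> U != 0 ->
  exists v : 'rV_d, [/\ v != 0, (v <= U)%MS
    & forall h, h \in H -> exists c, v *m rH h = c *: v].
Proof.
move=> cHH modU nzU; have [V simV sVU] := dec_mxsimple_exists modU nzU.
have [modV nzV _] := simV.
have rV : \rank V = 1%N.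
  by apply: (mxsimple_abelian_linear _ cHH simV); apply: group_closure_closed_field.
have nzv : nz_row V != 0 by rewrite nz_row_eq0.
have sVv : (V <= nz_row V)%MS.
  have [_ <-] := mxrank_leqif_sup (nz_row_sub V).
  by rewrite rV eqn_leq rank_leq_row lt0n mxrank_eq0 nzv.
exists (nz_row V); split=> //; first exact: submx_trans (nz_row_sub V) sVU.
move=> h Hh; apply/sub_rVP/(submx_trans _ sVv).
by apply: submx_trans (submxMr _ (nz_row_sub V)) (mxmoduleP modV h Hh).
Qed.

(** Schur's lemma: the kernel of [M] is a proper submodule, hence zero. Equality of degrees then
    comes either from irreducibility of the target, as the image is a nonzero submodule, or from the
    bound on its degree. *)
Lemma mx_rsim_intertwiner (F : fieldType) (gT : finGroupType) (G : {group gT})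
    (d1 d2 : nat) (rG1 : mx_representation F G d1) (rG2 : mx_representation F G d2)
    (M : 'M_(d1, d2)) :
  mx_irreducible rG1 -> mx_irreducible rG2 \/ (d2 <= d1)%N -> M != 0 ->
  {in G, forall g, rG1 g *m M = M *m rG2 g} -> mx_rsim rG1 rG2.
Proof.
move=> /mx_irrP[_ irr1] irr2 nzM MG.
have freeM : row_free M.
  rewrite -kermx_eq0; apply: contraTT nzM => nzK.
  have /irr1/(_ nzK) fullK : mxmodule rG1 (kermx M).
    apply/mxmoduleP=> g Gg; apply/sub_kermxP.
    by rewrite -mulmxA MG // mulmxA mulmx_ker mul0mx.
  apply/negPn/eqP; rewrite -[M]mul1mx.
  by apply/sub_kermxP; rewrite sub1mx.
suff d12 : d1 = d2 by exists M.
apply/eqP; rewrite eqn_leq -{1}(eqP freeM) rank_leq_col /=.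
case: irr2 => [/mx_irrP[_ irr2]|//].
have /irr2 : mxmodule rG2 <<M>>%MS.
  apply/mxmoduleP=> g Gg; rewrite (eqmxMr _ (genmxE M)) genmxE -MG //.
  exact: submxMl.
rewrite -mxrank_eq0 genmxE mxrank_eq0 => /(_ nzM).
by rewrite /row_full genmxE => /eqP <-; rewrite rank_leq_row.
Qed.

(** * Irreducible representations of the holomorph *)

Section Holomorph.

Variables (F : closedFieldType) (p n r : nat) (gT : finGroupType).
Variables (G : {group gT}) (a b : gT) (zeta : F).
Hypotheses (p_prime : prime p) (n_gt0 : (0 < n)%N).
Hypothesis r_prim : (totient (p ^ n)).-primitive_root (r%:R : 'Z_(p ^ n)).
Hypothesis zeta_prim : (p ^ n).-primitive_root zeta.
Hypothesis G_def : (<[b]> * <[a]>)%g = G.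
Hypothesis G_TI : (<[b]> :&: <[a]>)%g = 1%g.
Hypothesis ab_rel : (b^-1 * a * b = a ^+ r)%g.
Hypotheses (ord_a : #[a]%g = (p ^ n)%N) (ord_b : #[b]%g = totient (p ^ n)).

Let Ga : a \in G.
Proof. by rewrite -cycle_subG -G_def mulG_subr. Qed.

Let Gb : b \in G.
Proof. by rewrite -cycle_subG -G_def mulG_subl. Qed.

Let pX_gt0 k : (0 < p ^ k)%N.
Proof. by rewrite expn_gt0 prime_gt0. Qed.

Let tot_gt0 k : (0 < totient (p ^ k))%N.
Proof. by rewrite totient_gt0. Qed.

Let G_form g : g \in G -> exists i j, g = (b ^+ j * a ^+ i)%g.
Proof.
by rewrite -G_def => /mulsgP[_ _ /cycleP[j ->] /cycleP[i ->] ->]; exists i, j.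
Qed.

Lemma conjg_aX i j l : ((a ^+ l) ^ (b ^+ j * a ^+ i) = a ^+ (l * r ^ j))%g.
Proof.
rewrite conjgM (conjg_expgn ab_rel) conjXg; congr (_ ^+ _)%g.
by rewrite conjgE -expgS expgSr mulKg.
Qed.

Lemma dvdn_totient_pfactor k : (k <= n)%N -> (totient (p ^ k) %| totient (p ^ n))%N.
Proof.
move=> le_kn; rewrite (dvdn_totient_root p_prime n_gt0 r_prim _ le_kn).
rewrite -(modn_dvdm _ (dvdn_exp2l p le_kn)).
have /eqP-> : r ^ totient (p ^ n) == 1 %[mod p ^ n].
  by rewrite -(dvdn_totient_root p_prime n_gt0 r_prim).
by rewrite modn_dvdm ?dvdn_exp2l.
Qed.

(* b^phi(p^k) acts on rho_(k,w) as w, so w ranges over the roots of unity of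
   this order; unlike p^(n-k), it is also right for k = 0. *)
Definition scalar_order k := (totient (p ^ n) %/ totient (p ^ k))%N.

Lemma mul_scalar_order k : (k <= n)%N ->
  (totient (p ^ k) * scalar_order k = totient (p ^ n))%N.
Proof. by move=> le_kn; rewrite mulnC divnK // dvdn_totient_pfactor. Qed.

Lemma scalar_order_gt0 k : (k <= n)%N -> (0 < scalar_order k)%N.
Proof.
by move=> le_kn; rewrite divn_gt0 ?tot_gt0 // dvdn_leq ?tot_gt0 ?dvdn_totient_pfactor.
Qed.

Lemma scalar_order0 : scalar_order 0 = totient (p ^ n).
Proof. by rewrite /scalar_order expn0 divn1. Qed.

Lemma scalar_orderE k : (0 < k <= n)%N -> scalar_order k = (p ^ (n - k))%N.
Proof.
case/andP=> k_gt0 le_kn; rewrite /scalar_order !totient_pfactor //.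
have -> : (p ^ n.-1 = p ^ (n - k) * p ^ k.-1)%N.
  by rewrite -expnD; congr (p ^ _)%N; rewrite -!subn1 addnBA // subnK.
rewrite mulnCA mulnK //.
by rewrite muln_gt0 pX_gt0 andbT; case: (p) (prime_gt1 p_prime) => [|[]].
Qed.

(** A predicate rather than a function of [w], since the two matrices extend to [G] only for
    suitable roots of unity [w]. *)
Definition is_rho k w (sigma : mx_representation F G (totient (p ^ k))) :=
  sigma a = rho_a p n r zeta k /\ sigma b = rho_b p k w.

Lemma rho_exists k w : (k <= n)%N -> w ^+ scalar_order k = 1 ->
  {sigma | @is_rho k w sigma}.
Proof.
move=> le_kn w1; apply: (metacyclic_repr (r := r)) => //.
- by rewrite ord_a rho_a_order.
- rewrite ord_b -(mul_scalar_order le_kn) exprM (rho_b_exp _ _ p_prime).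
  suff -> m : (w%:M : 'M_(totient (p ^ k))) ^+ m = (w ^+ m)%:M by rewrite w1.
  elim: m => [|m IHm]; first by rewrite !expr0.
  by rewrite !exprS IHm -mulmxE -scalar_mxM.
- exact: rho_ab_rel.
Qed.

(** * Irreducibility and recognition of rho for one orbit *)

Section FixedOrbit.

Variables (k : nat) (w : F) (sigma : mx_representation F G (totient (p ^ k))).
Hypotheses (le_kn : (k <= n)%N) (nz_w : w != 0) (rho_sigma : is_rho w sigma).

Local Notation d := (totient (p ^ k)).
Local Notation D := (basis_row F p k).

Lemma rho_irreducible : mx_irreducible sigma.
Proof.
have [sa sb] := rho_sigma; apply/mx_irrP; split=> // U modU nzU.
have sAG : <[a]> \subset G by rewrite cycle_subG.
have [|v [nzv svU /(_ a (cycle_id a))[c /= va]]] :=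
    abelian_eigenvector (cycle_abelian a) (rH := subg_repr sigma sAG) _ nzU.
  by apply/mxmoduleP=> h Ah; apply: (mxmoduleP modU); apply: (subsetP sAG).
have [i nz_vi] : exists i, v 0 i != 0.
  by apply/existsP; apply: contraNT nzv => /existsPn v0;
     apply/eqP/rowP=> j; rewrite mxE; apply/eqP/negPn.
have v_j j : v 0 j * zeta ^+ (r ^ j * p ^ (n - k)) = c * v 0 j.
  have /rowP/(_ j) := va; rewrite sa !mxE (bigD1 j) //= big1 => [|l /negPf j'l].
    by rewrite mxE eqxx addr0.
  by rewrite mxE j'l mulr0.
(* The eigenvalues of [a] on the basis rows are distinct, so an eigenvector has a single nonzero
   coordinate. *)
have Dv : v = v 0 i *: D i.
  apply/rowP=> j; rewrite !mxE; case: eqP => [/val_inj ->|/eqP i'j].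
    by rewrite mulr1.
  rewrite mulr0; apply: contraNeq i'j => nz_vj.
  have: zeta ^+ (r ^ j * p ^ (n - k)) == zeta ^+ (r ^ i * p ^ (n - k)).
    apply/eqP/(mulfI nz_vj); rewrite v_j mulrC; congr (_ * _).
    by apply: (mulfI nz_vi); rewrite v_j mulrC.
  by rewrite (eq_zeta_root_expr p_prime n_gt0) // !modn_small ?ltn_ord.
apply: basis_row_full => j lt_j.
have [m [x [nzx]]] := basis_row_orbit p_prime (ltn_ord i) lt_j nz_w.
have -> : D i = (v 0 i)^-1 *: v by rewrite {2}Dv scalerA mulVf // scale1r.
rewrite -sb -repr_mx_exp // => Dj; rewrite -(eqmx_scale _ nzx) -Dj -scalemxAl.
apply: scalemx_sub; apply: submx_trans (submxMr _ svU) _.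
by apply: (mxmoduleP modU); rewrite groupX.
Qed.

(** Inverse powers of [b] appear because matrices act on rows:
    [b ^- t * a = a ^+ (r ^ t) * b ^- t]. *)
Lemma repr_mx_conj_a d' m (V : mx_representation F G d') (v : 'M_(m, d')) c t :
  v *m V a = c *: v ->
  v *m V (b ^- t)%g *m V a = c ^+ (r ^ t) *: (v *m V (b ^- t)%g).
Proof.
move=> va; rewrite -mulmxA -repr_mxM ?groupV ?groupX //.
have -> : (b ^- t * a = a ^+ (r ^ t) * b ^- t)%g.
  have := conjg_expgn ab_rel 1 t; rewrite mul1n expg1 => <-.
  by rewrite conjgE -mulgA mulgK.
by rewrite repr_mxM ?groupV ?groupX // mulmxA (repr_mx_eigenX _ Ga va) scalemxAl.
Qed.

(** The recognition criterion: one common eigenvector of [a] and [b ^+ d] determines the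
    representation. The first alternative of the disjunction serves the classification of
    irreducibles; the second serves induced representations, where a degree bound is available
    instead. *)
Lemma rho_rsim d' (V : mx_representation F G d') (v : 'rV_d') u :
  mx_irreducible V \/ (d' <= d)%N -> v != 0 -> coprime p u ->
  v *m V a = zeta ^+ (u * p ^ (n - k)) *: v -> v *m V (b ^+ d)%g = w *: v ->
  mx_rsim sigma V.
Proof.
move=> irrV nzv co_u va vb; have [sa sb] := rho_sigma.
have [i Di] := exp_root_surj p_prime n_gt0 r_prim le_kn co_u.
(* The rows v b^-(j + t0) have the same a-eigenvalues as the basis rows of sigma. *)
pose t0 := (i * (totient (p ^ n)).-1)%N.
pose M : 'M_(d, d') := \matrix_j (v *m V (b ^- (j + t0))%g).
have DM j : (j < d)%N -> D j *m M = v *m V (b ^- (j + t0))%g.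
  move=> lt_j; rewrite -[j]/(nat_of_ord (Ordinal lt_j)) basis_rowE -rowE.
  by rewrite rowK.
apply: (mx_rsim_intertwiner (M := M)) rho_irreducible irrV _ _.
  apply: contraNneq nzv => M0; have := DM 0 (tot_gt0 k).
  rewrite M0 mulmx0 => /(congr1 (mulmx^~ (V (b ^+ (0 + t0))%g))).
  by rewrite mul0mx -mulmxA -repr_mxM ?groupV ?groupX // mulVg repr_mx1 mulmx1 => <-.
have Ma : sigma a *m M = M *m V a.
  apply: basis_row_mulmx_inj => j lt_j.
  rewrite !mulmxA sa basis_row_a -scalemxAl DM // (repr_mx_conj_a _ va) -exprM.
  congr (_ *: _); apply/eqP; rewrite mulnAC (eq_zeta_expr p_prime le_kn zeta_prim).
  (* [t0] is a natural number standing for [- i] modulo [totient (p ^ n)], so [r ^ t0] inverts [u]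
     modulo [p ^ k]. *)
  have -> : (u * r ^ (j + t0) = r ^ (j + i * totient (p ^ n)) %[mod p ^ k])%N.
    rewrite -modnMml -Di modnMml -expnD; congr (r ^ _ %% _)%N.
    by rewrite addnCA -mulnS prednK.
  rewrite (eqn_exp_mod_pfactor p_prime n_gt0 r_prim) //.
  rewrite -(divnK (dvdn_totient_pfactor le_kn)) mulnA addnC.
  by rewrite modnMDl.
have Mb : sigma b *m M = M *m V b.
  (* In row 0 the factor [w] is absorbed as the action of [b ^+ d] on [v]. *)
  apply: basis_row_mulmx_inj => -[|j] lt_j; rewrite !mulmxA sb.
    rewrite basis_row_b0 // -scalemxAl !DM ?prednK // scalemxAl -vb -!mulmxA.
    rewrite -!repr_mxM ?groupM ?groupV ?groupX // add0n; congr (_ *m V _).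
    rewrite addnC expgD invMg -{1}(prednK (tot_gt0 k)) expgS mulgA mulgK.
    exact: (commuteV (commuteX t0 (commute_refl b))).
  rewrite basis_row_bS // !DM ?(ltnW lt_j) // -mulmxA -repr_mxM ?groupV ?groupX //.
  by rewrite addSn expgS invMg mulgKV.
have MX g i' : g \in G -> sigma g *m M = M *m V g ->
    sigma (g ^+ i')%g *m M = M *m V (g ^+ i')%g.
  move=> Gg Mg; elim: i' => [|i' IHi]; first by rewrite !repr_mx1 mul1mx mulmx1.
  by rewrite expgS !repr_mxM ?groupX // -mulmxA IHi !mulmxA Mg.
move=> g /G_form[i' [j ->]].
by rewrite !repr_mxM ?groupX // -mulmxA MX // !mulmxA MX.
Qed.

End FixedOrbit.

Lemma rho_bX k w sigma : @is_rho k w sigma -> sigma (b ^+ totient (p ^ k))%g = w%:M.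
Proof. by case=> _ sb; rewrite repr_mx_exp // sb rho_b_exp. Qed.

Lemma rho_inj k w w' sigma sigma' :
  @is_rho k w sigma -> @is_rho k w' sigma' -> mx_rsim sigma sigma' -> w = w'.
Proof.
move=> /rho_bX sw /rho_bX sw' sim.
have := mx_rsim_scalar (groupX _ Gb) sim sw; rewrite sw'.
pose o := Ordinal (tot_gt0 k).
by move/matrixP/(_ o o); rewrite !mxE eqxx !mulr1n.
Qed.

Lemma scalar_order_eigenvalue k d' (V : mx_representation F G d') (v : 'rV_d') w :
  (k <= n)%N -> v != 0 -> v *m V (b ^+ totient (p ^ k))%g = w *: v ->
  w ^+ scalar_order k = 1.
Proof.
move=> le_kn nzv vb.
have := repr_mx_eigenX (scalar_order k) (groupX _ Gb) vb.
rewrite -expgM mul_scalar_order // -ord_b expg_order repr_mx1 mulmx1.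
by move/esym/(scale_fixed nzv).
Qed.

Lemma scalar_order_neq0 k (w : F) :
  (k <= n)%N -> w ^+ scalar_order k = 1 -> w != 0.
Proof.
move=> le_kn; apply: contra_eq_neq => ->.
by rewrite expr0n gtn_eqF ?scalar_order_gt0 // eq_sym oner_eq0.
Qed.

Lemma irr_rsim_rho d' (V : mx_representation F G d') : mx_irreducible V ->
  exists k w, [/\ (k <= n)%N, w ^+ scalar_order k = 1
    & forall sigma, @is_rho k w sigma -> mx_rsim sigma V].
Proof.
move=> irrV; have [_ nz1 _] := irrV.
have sAG : <[a]> \subset G by rewrite cycle_subG.
have [|v1 [nzv1 _ /(_ a (cycle_id a))[c /= v1a]]] :=
  abelian_eigenvector (cycle_abelian a) (rH := subg_repr V sAG) _ nz1.
  exact: mxmodule1.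
have cpn : c ^+ (p ^ n) = 1.
  have := repr_mx_eigenX (p ^ n) Ga v1a.
  by rewrite -ord_a expg_order repr_mx1 mulmx1 => /esym/(scale_fixed nzv1).
(* Write the exponent of [zeta] as [u] times a power of [p]; the valuation is [n - k]. The
   eigenvalue 1 is put at [k = 0] with [u = 1]. *)
have [k [u [le_kn co_u Dc]]] : exists k u,
    [/\ (k <= n)%N, coprime p u & c = zeta ^+ (u * p ^ (n - k))].
  have [i ->] := prim_rootP zeta_prim cpn.
  have [->|i_gt0] := posnP i.
    exists 0%N, 1%N; rewrite coprimen1 subn0 mul1n expr0.
    by rewrite (prim_expr_order zeta_prim).
  have [u co_u Di] := pfactor_coprime p_prime i_gt0.
  have le_ln : (logn p i <= n)%N.
    rewrite -(leq_exp2l _ _ (prime_gt1 p_prime)) (leq_trans _ (ltnW (ltn_ord i))) //.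
    by rewrite dvdn_leq // pfactor_dvdnn.
  by exists (n - logn p i)%N, u; rewrite leq_subr co_u subKn // {1}Di.
set d := totient (p ^ k).
have sBG : <[(b ^- d)%g]> \subset G by rewrite cycle_subG groupV groupX.
pose U := eigenspace (V a) c.
have nzU : U != 0.
  by apply: contraNneq nzv1 => U0; rewrite -submx0 -U0; apply/eigenspaceP.
have modU : mxmodule (subg_repr V sBG) U.
  (* Powers of [b ^- d] keep the eigenvalue [c], because [r ^ d] is 1 modulo [p ^ k]. *)
  apply/mxmoduleP=> _ /cycleP[m ->]; apply/eigenspaceP.
  rewrite /= expgVn -expgM (repr_mx_conj_a _ (c := c)); last exact/eigenspaceP.
  rewrite Dc -exprM mulnAC; congr (_ *: _); apply/eqP.
  rewrite (eq_zeta_expr p_prime le_kn zeta_prim) -modnMmr.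
  have /eqP-> : r ^ (d * m) == 1 %[mod p ^ k].
    by rewrite -(dvdn_totient_root p_prime n_gt0 r_prim) ?dvdn_mulr.
  by rewrite modnMmr muln1.
have [v [nzv svU vB]] := abelian_eigenvector (cycle_abelian _) modU nzU.
have [w vb] : exists w, v *m V (b ^+ d)%g = w *: v.
  by apply: vB; rewrite /= cycleV cycle_id.
have w1 := scalar_order_eigenvalue le_kn nzv vb.
exists k, w; split=> // sigma rho_sigma.
apply: (rho_rsim le_kn (scalar_order_neq0 le_kn w1) rho_sigma _ nzv co_u _ vb).
  by left.
by rewrite -Dc; apply/eigenspaceP.
Qed.

(** * The little group method *)

Section LittleGroup.

Variables (k s : nat) (psi : mx_representation F <[a]> 1).
Hypotheses (le_kn : (k <= n)%N) (co_s : coprime p s).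
Hypothesis psi_a : psi a = (zeta ^+ (s * p ^ (n - k)))%:M.

Local Notation d := (totient (p ^ k)).
Local Notation I := (stab_group G psi).

Lemma psi_aX l : psi (a ^+ l)%g = (zeta ^+ (s * l * p ^ (n - k)))%:M.
Proof.
rewrite repr_mx_exp ?cycle_id // psi_a mulnAC [in RHS]exprM.
elim: l => [|l IHl]; first by rewrite !expr0.
by rewrite !exprS IHl -mulmxE -scalar_mxM.
Qed.

(** Conjugation by this element raises [a] to the power [r ^ j], so [psi] is fixed exactly when
    [s * r ^ j] equals [s] modulo [p ^ k]; writing [s] as a power of [r] turns this into
    divisibility. *)
Lemma mem_stab i j : (b ^+ j * a ^+ i \in stab G psi)%g = (d %| j)%N.
Proof.
rewrite inE; apply/andP/idP=> [[_ /forall_inP/(_ a (cycle_id a))]|dvd_j].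
  rewrite -[a in (a ^ _)%g]expg1 conjg_aX psi_aX psi_a => /eqP/matrixP/(_ 0 0).
  rewrite !mxE eqxx => /eqP; rewrite (eq_zeta_expr p_prime le_kn zeta_prim) mul1n.
  have [i0 Di0] := exp_root_surj p_prime n_gt0 r_prim le_kn co_s.
  rewrite -modnMml -Di0 modnMml -expnD (eqn_exp_mod_pfactor p_prime n_gt0 r_prim) //.
  by rewrite -{2}[i0]addn0 eqn_modDl mod0n.
split.
  rewrite inE groupM ?groupX // inE -cycleJ cycle_subG -[a in (a ^ _)%g]expg1.
  by rewrite conjg_aX mem_cycle.
apply/forall_inP=> _ /cycleP[l ->]; rewrite conjg_aX !psi_aX.
suff /eqP-> : zeta ^+ (s * (l * r ^ j) * p ^ (n - k)) == zeta ^+ (s * l * p ^ (n - k)) by [].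
rewrite (eq_zeta_expr p_prime le_kn zeta_prim) mulnA -modnMmr.
move: dvd_j; rewrite (dvdn_totient_root p_prime n_gt0 r_prim) // => /eqP->.
by rewrite modnMmr muln1.
Qed.

Lemma stab_form h : h \in I -> exists i m, h = ((b ^+ d) ^+ m * a ^+ i)%g.
Proof.
move=> Ih; have /G_form[i [j Dh]] : h \in G.
  by move: Ih; rewrite inE => /andP[]; rewrite inE => /andP[].
move: Ih; rewrite {1}Dh mem_stab => /dvdnP[m Dj].
by exists i, m; rewrite Dh Dj mulnC expgM.
Qed.

Lemma cycle_a_sub_stab : <[a]> \subset I.
Proof.
by rewrite cycle_subG; have := mem_stab 1 0; rewrite expg0 mul1g expg1 dvdn0.
Qed.

Lemma bd_stab : (b ^+ d)%g \in I.
Proof. by have := mem_stab 0 d; rewrite expg0 mulg1 dvdnn. Qed.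

Lemma card_rcosets_stab : (#|rcosets I G| <= d)%N.
Proof.
rewrite -[leqRHS]card_ord.
suff sub_im : rcosets I G \subset [set (I :* b ^+ val j)%g | j : 'I_d].
  exact: leq_trans (subset_leq_card sub_im) (leq_imset_card _ _).
apply/subsetP=> _ /rcosetsP[g Gg ->].
have [i [j Dg]] : exists i j, g = (a ^+ i * b ^+ j)%g.
  have [i [j Dg]] := G_form (groupVr Gg).
  have /cycleP[i' Di] : (a ^- i)%g \in <[a]>%g by rewrite groupV mem_cycle.
  have /cycleP[j' Dj] : (b ^- j)%g \in <[b]>%g by rewrite groupV mem_cycle.
  by exists i', j'; rewrite -[g]invgK Dg invMg Di Dj.
apply/imsetP; exists (Ordinal (ltn_pmod j (tot_gt0 k))) => //=.
rewrite Dg {1}(divn_eq j d) expgD mulgA rcosetM rcoset_id //.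
rewrite groupM //; last by rewrite mulnC expgM groupX // bd_stab.
by apply: (subsetP cycle_a_sub_stab); rewrite mem_cycle.
Qed.

(** The little group lies in the cyclic group [<[b]>], so its irreducible [rho] is linear and [W] is
    a single row, a common eigenvector of [a] and [b ^+ d]. The translates of [W] bound the degree
    of [V] by [d]. *)
Lemma little_group_rsim V : @little_group F gT G <[a]> <[b]> psi V ->
  exists2 w, w ^+ scalar_order k = 1
    & forall sigma, @is_rho k w sigma -> mx_rsim sigma V.
Proof.
case=> m [rho [tau [irr_rho tau_rho [W [freeW WV _ fullW]]]]].
have cHH : abelian (I :&: <[b]>)%G.
  exact: abelianS (subsetIr _ _) (cycle_abelian b).
have m1 : m = 1%N.
  by apply: (mx_irr_abelian_linear _ irr_rho cHH); apply: group_closure_closed_field.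
subst m.
have WX h x : h \in I -> tau h = x%:M -> W *m V h = x *: W.
  by move=> Ih tau_h; rewrite WV // tau_h mul_scalar_mx.
have Hbd : (b ^+ d)%g \in (I :&: <[b]>)%g by rewrite inE bd_stab mem_cycle.
have va : W *m V a = zeta ^+ (s * p ^ (n - k)) *: W.
  apply: WX; first by rewrite (subsetP cycle_a_sub_stab) ?cycle_id.
  have := tau_rho a 1%g (cycle_id a) (group1 _).
  by rewrite mulg1 repr_mx1 psi_a !mxE eqxx scale_scalar_mx mulr1.
have [w vb] : exists w, W *m V (b ^+ d)%g = w *: W.
  exists (rho (b ^+ d)%g 0 0); apply: WX; first exact: bd_stab.
  have := tau_rho 1%g _ (group1 _) Hbd.
  by rewrite mul1g repr_mx1 !mxE eqxx scale1r => ->; apply: mx11_scalar.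
have nzW : W != 0 by rewrite -mxrank_eq0 (eqP freeW).
have w1 := scalar_order_eigenvalue le_kn nzW vb.
exists w => // sigma rho_sigma.
apply: (rho_rsim le_kn (scalar_order_neq0 le_kn w1) rho_sigma _ nzW co_s va vb).
right; rewrite -(eqP fullW).
apply: leq_trans (mxrank_sum_leqif _).1 _; rewrite /=.
apply: leq_trans card_rcosets_stab; rewrite -sum1_card leq_sum // => C _.
by rewrite genmxE rank_leq_row.
Qed.

(** [W] is the basis row on which [a] acts as in [psi]; its index is the logarithm of [s] to base
    [r], reduced modulo [d]. The inertia group acts on this line by scalars, and [b] moves the line
    through all basis lines. *)
Lemma little_group_rho w sigma : w != 0 -> @is_rho k w sigma ->
  @little_group F gT G <[a]> <[b]> psi (Representation sigma).
Proof.
move=> nzw rho_sigma; have [sa sb] := rho_sigma.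
have [i0 Di0] := exp_root_surj p_prime n_gt0 r_prim le_kn co_s.
have lt_i : (i0 %% d < d)%N by rewrite ltn_mod.
pose i := Ordinal lt_i; pose W := basis_row F p k i.
have sIG : I \subset G.
  by apply/subsetP=> h; rewrite inE => /andP[]; rewrite inE => /andP[].
have Wa : W *m sigma a = zeta ^+ (s * p ^ (n - k)) *: W.
  rewrite sa basis_row_a; congr (_ *: _); apply/eqP.
  rewrite (eq_zeta_expr p_prime le_kn zeta_prim) -Di0.
  rewrite (eqn_exp_mod_pfactor p_prime n_gt0 r_prim) //=.
  by rewrite modn_mod.
have W_inj x y : x *: W = y *: W -> x = y.
  by move/rowP/(_ i); rewrite !mxE eqxx !mulr1.
have Wh h : h \in I -> W *m sigma h = sigma h i i *: W.
  move=> Ih; suff [c Wc] : exists c, W *m sigma h = c *: W.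
    rewrite Wc; congr (_ *: _); move/rowP/(_ i): Wc.
    by rewrite /W basis_rowE -rowE !mxE !eqxx mulr1 => ->.
  have [l [m ->]] := stab_form Ih; exists (w ^+ m * zeta ^+ (s * p ^ (n - k)) ^+ l).
  rewrite repr_mxM ?groupX // mulmxA (repr_mx_eigenX (c := w) m) ?groupX //.
    by rewrite -scalemxAl (repr_mx_eigenX l Ga Wa) scalerA.
  by rewrite (rho_bX rho_sigma) mul_mx_scalar.
(* The scalar by which [h] acts on [W] is read off the diagonal entry; restricting to the little
   group gives the [rho] of the construction. *)
pose f h : 'M[F]_1 := (sigma h i i)%:M.
have f_repr : mx_repr I f.
  split=> [|g h Ig Ih]; first by rewrite /f repr_mx1 mxE eqxx.
  rewrite /f -scalar_mxM; congr (_%:M); apply: W_inj; rewrite -Wh ?groupM //.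
  by rewrite repr_mxM ?(subsetP sIG) // mulmxA Wh // -scalemxAl Wh // scalerA.
pose tau := MxRepresentation f_repr.
have tauE h : tau h = (sigma h i i)%:M by [].
exists 1%N, (subg_repr tau (subsetIl _ _)), tau; split.
- exact/mx_abs_irrW/linear_mx_abs_irr.
- move=> x h Nx; rewrite inE => /andP[Ih Bh].
  have Ix := subsetP cycle_a_sub_stab x Nx.
  rewrite repr_mxM //= mul_scalar_mx; congr (_ *: _); apply: W_inj; rewrite -Wh //.
  have /cycleP[l ->] := Nx; rewrite (repr_mx_eigenX l Ga Wa) psi_aX mxE eqxx.
  by rewrite -exprM mulnAC.
have freeW : row_free W.
  by rewrite /row_free /W basis_rowE mxrank_delta.
have fullS : row_full (\sum_(C in rcosets I G) <<W *m sigma (repr C)>>)%MS.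
  apply: (basis_row_full (F := F)) => j lt_j.
  have [m [x [nzx]]] := basis_row_orbit p_prime lt_i lt_j nzw.
  rewrite -sb -repr_mx_exp // => Dj; rewrite -(eqmx_scale _ nzx) -Dj.
  set g := (b ^+ m)%g; have Gg : g \in G by rewrite groupX.
  apply: (sumsmx_sup (I :* g)%g); first by apply/rcosetsP; exists g.
  rewrite genmxE; have /rcosetP[h Ih ->] := mem_repr_rcoset I g.
  (* The chosen representative of the coset differs from [g] by an element of the inertia group,
     which only rescales [W]. *)
  have -> : sigma g = sigma h^-1%g *m sigma (h * g)%g.
    have Gh := subsetP sIG h Ih.
    by rewrite -repr_mxM ?mulKg // ?groupV // groupM.
  by rewrite mulmxA (Wh h^-1%g) ?groupV // -scalemxAl scalemx_sub.
exists W; split=> //; first by move=> h Ih; rewrite tauE mul_scalar_mx Wh.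
(* At most [d] lines spanning a space of dimension [d] form a direct sum. *)
rewrite mxdirectE /= eqn_leq (mxrank_sum_leqif _).1 /= (eqP fullS).
apply: leq_trans card_rcosets_stab; rewrite -sum1_card leq_sum // => C _.
by rewrite genmxE rank_leq_row.
Qed.

End LittleGroup.

(** * Faithfulness and counting *)

(** For [k = n] the matrix of [a] has order [p ^ n]. If [b ^+ j * a ^+ i] acts trivially, so does
    conjugation by it, whence [r ^ j] is 1 modulo [p ^ n] and [b ^+ j = 1]; then [a ^+ i = 1]. *)
Lemma rho_faithful w sigma : @is_rho n w sigma -> mx_faithful sigma.
Proof.
case=> sa _; apply/subsetP=> g /rkerP[Gg g1].
pose o := Ordinal (tot_gt0 n).
have aX_inj x y : sigma (a ^+ x)%g = sigma (a ^+ y)%g -> x = y %[mod p ^ n].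
  rewrite !repr_mx_exp // sa => /matrixP/(_ o o).
  rewrite !rho_a_exp eqxx subnn !mul1n => /eqP.
  by rewrite (eq_prim_root_expr zeta_prim) => /eqP.
have [i [j Dg]] := G_form Gg.
have : sigma (a ^+ (1 * r ^ j))%g = sigma (a ^+ 1)%g.
  rewrite -(conjg_aX i) -Dg expg1 conjgE !repr_mxM ?groupV // ?groupM //.
  by rewrite repr_mxV // g1 invmx1 mul1mx mulmx1.
move/aX_inj/eqP; rewrite mul1n -(dvdn_totient_root p_prime n_gt0 r_prim) //.
rewrite -ord_b order_dvdn => /eqP bj1; move: g1; rewrite Dg bj1 mul1g.
rewrite -(repr_mx1 sigma) -(expg0 a) => /aX_inj/eqP.
by rewrite mod0n -ord_a -/(dvdn _ _) order_dvdn inE.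
Qed.

(** For [k < n] the nontrivial element [a ^+ (p ^ n.-1)] lies in the kernel. *)
Lemma faithful_rho k w sigma :
  (k <= n)%N -> @is_rho k w sigma -> mx_faithful sigma -> k = n.
Proof.
move=> le_kn [sa _] /subsetP/(_ (a ^+ (p ^ n.-1))%g) fful.
apply/eqP; rewrite eqn_leq le_kn leqNgt; apply/negP=> lt_kn.
have /fful : (a ^+ (p ^ n.-1))%g \in rker sigma.
  apply/rkerP; split; first exact: groupX.
  rewrite repr_mx_exp // sa; apply/matrixP=> i j; rewrite rho_a_exp mxE.
  case: eqP => // _; rewrite -mulnA -expnD.
  have -> : (n - k + n.-1 = n + (n - k).-1)%N.
    by rewrite -!subn1 [in LHS]addnBA // [in RHS]addnBA ?subn_gt0 // addnC.
  by rewrite expnD mulnCA exprM (prim_expr_order zeta_prim) expr1n.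
rewrite inE -order_dvdn ord_a dvdn_Pexp2l ?prime_gt1 //.
by case: (n) n_gt0 => // m _; rewrite ltnn.
Qed.

Lemma exactly_fin (T : finType) (f : T -> representation F G) P :
  (forall t, P (f t)) -> (forall t u, mx_rsim (f t) (f u) -> t = u) ->
  (forall V : representation F G, P V -> exists t, mx_rsim V (f t)) ->
  exactly #|T| P.
Proof.
move=> Pf f_inj f_surj; exists (fun i => f (enum_val i)); split=> [i|i j|V /f_surj[t Vt]].
- exact: Pf.
- by move/f_inj/enum_val_inj.
- by exists (enum_rank t); rewrite enum_rankK.
Qed.

Lemma exactly_rho k (y : F) (f : F -> mx_representation F G (totient (p ^ k)))
    (P : representation F G -> Prop) :
  (k <= n)%N -> (scalar_order k).-primitive_root y ->
  (forall w, w ^+ scalar_order k = 1 -> is_rho w (f w)) ->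
  (forall w, w ^+ scalar_order k = 1 -> P (Representation (f w))) ->
  (forall V : representation F G, P V ->
     exists2 w, w ^+ scalar_order k = 1 & mx_rsim V (f w)) ->
  exactly (scalar_order k) P.
Proof.
move=> le_kn y_prim f_rho Pf f_surj.
have y1 i : (y ^+ i) ^+ scalar_order k = 1.
  by rewrite exprAC (prim_expr_order y_prim) expr1n.
rewrite -[scalar_order k]card_ord.
apply: (@exactly_fin _ (fun i : 'I__ => Representation (f (y ^+ i)))) => [i|i j|V].
- exact: Pf.
- move/(rho_inj (f_rho _ (y1 i)) (f_rho _ (y1 j)))/eqP.
  rewrite (eq_prim_root_expr y_prim) !modn_small ?ltn_ord // => /eqP.
  exact: val_inj.
- move/f_surj=> [w w1 Vw]; have [i Dw] := prim_rootP y_prim w1.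
  by exists i; rewrite -Dw.
Qed.

(** The term [k = 0] is [p ^ n - p ^ n.-1], and the terms [k = 1, ..., n] are the powers
    [p ^ (n - k)], the geometric sum read backwards. *)
Lemma sum_scalar_order :
  (\sum_(k < n.+1) scalar_order k = \sum_(0 <= i < n.+1) p ^ i - p ^ n.-1)%N.
Proof.
have sumE : (\sum_(i < n) scalar_order (lift ord0 i) = \sum_(0 <= i < n) p ^ i)%N.
  rewrite big_mkord [RHS](reindex_inj rev_ord_inj).
  by apply: eq_bigr => i _; rewrite lift0 scalar_orderE /=.
have tot_n : (totient (p ^ n) + p ^ n.-1 = p ^ n)%N.
  rewrite totient_pfactor // addnC -mulSn prednK ?prime_gt0 //.
  by rewrite -expnS prednK.
rewrite big_ord_recl sumE scalar_order0 big_nat_recr //=.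
rewrite -[X in (_ + X - _)%N]tot_n addnA addnK.
exact: addnC.
Qed.

Lemma exactly_irr (z : nat -> F)
    (f : forall k, F -> mx_representation F G (totient (p ^ k))) :
  odd p ->
  (forall k, (k <= n)%N -> (scalar_order k).-primitive_root (z k)) ->
  (forall k w, (k <= n)%N -> w ^+ scalar_order k = 1 -> is_rho w (f k w)) ->
  exactly (\sum_(0 <= i < n.+1) p ^ i - p ^ n.-1)%N
    (fun V : representation F G => mx_irreducible V).
Proof.
move=> p_odd z_prim f_rho.
have z1 k i : (k <= n)%N -> (z k ^+ i) ^+ scalar_order k = 1.
  by move=> le_kn; rewrite exprAC (prim_expr_order (z_prim k le_kn)) expr1n.
pose T := {k : 'I_n.+1 & 'I_(scalar_order k)}.
have <- : #|{: T}| = (\sum_(0 <= i < n.+1) p ^ i - p ^ n.-1)%N.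
  rewrite card_tagged sumnE big_map big_enum -sum_scalar_order.
  by apply: eq_bigr => k _; rewrite card_ord.
apply: (@exactly_fin _ (fun t : T =>
    Representation (f (tag t) (z (tag t) ^+ tagged t)))) => [[k i]|[k i] [k' i']|V].
- have le_kn : (k <= n)%N by rewrite -ltnS.
  apply: (rho_irreducible le_kn _ (f_rho _ _ le_kn (z1 _ _ le_kn))).
  by apply: (scalar_order_neq0 le_kn); rewrite z1.
- rewrite /= => sim; have le_kn : (k <= n)%N by rewrite -ltnS.
  have Ek : k = k'.
    (* Similar representations have equal degrees, which already determines [k]. *)
    apply/val_inj/(totient_pfactor_inj p_prime p_odd); exact: mxrank_rsim sim.
  case: k' / Ek in i' sim *; congr Tagged; apply: val_inj.
  move: sim => /(rho_inj (f_rho _ _ le_kn (z1 _ _ _)) (f_rho _ _ le_kn (z1 _ _ _))).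
  move/(_ le_kn le_kn)/eqP.
  by rewrite (eq_prim_root_expr (z_prim k le_kn)) !modn_small ?ltn_ord // => /eqP.
- case/irr_rsim_rho=> k [w [le_kn w1 simV]].
  have [i Dw] := prim_rootP (z_prim k le_kn) w1.
  pose k' := Ordinal (le_kn : (k < n.+1)%N).
  exists (@Tagged _ k' (fun k : 'I_n.+1 => 'I_(scalar_order k)) i).
  by rewrite /= -Dw; apply/mx_rsim_sym/simV/f_rho.
Qed.

(** * Values on an orbit, and families defined for all parameters *)

Lemma conj_orbit_value k (psi chi : mx_representation F <[a]> 1) :
  (k <= n)%N -> chi a = (zeta ^+ (p ^ (n - k)))%:M -> conj_orbit G chi psi ->
  exists2 s, coprime p s & psi a = (zeta ^+ (s * p ^ (n - k)))%:M.
Proof.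
move=> le_kn chi_a [g /G_form[i [j ->]] psiE].
exists (r ^ j)%N; first by rewrite coprimeXr // (coprime_root_base p_prime n_gt0 r_prim).
have := conjg_aX i j 1; rewrite expg1 mul1n psiE ?cycle_id // => ->.
by rewrite (psi_aX (s := 1) (k := k)) ?mul1n.
Qed.

(** Makes rho a total function of [k] and [w], with a trivial representation as default outside the
    admissible range. *)
Lemma rho_total k w :
  {sigma | (k <= n)%N -> w ^+ scalar_order k = 1 -> @is_rho k w sigma}.
Proof.
have triv : mx_repr G (fun=> 1%:M : 'M[F]_(totient (p ^ k))).
  by split=> // g h _ _; rewrite mulmx1.
have [le_kn|_] := boolP (k <= n)%N; last by exists (MxRepresentation triv).
have [/eqP w1|/eqP w1] := boolP (w ^+ scalar_order k == 1).
  by have [sigma ?] := rho_exists le_kn w1; exists sigma.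
by exists (MxRepresentation triv).
Qed.

(** The degenerate metacyclic case in which the second generator and the exponent [r] are both 1. *)
Lemma cycle_character i :
  {chi : mx_representation F <[a]> 1 | chi a = (zeta ^+ i)%:M}.
Proof.
have scalX (c : F) m : (c%:M : 'M_1) ^+ m = (c ^+ m)%:M.
  elim: m => [|m IHm]; first by rewrite !expr0.
  by rewrite !exprS IHm -mulmxE -scalar_mxM.
have [||||||chi [chi_a _]] := @metacyclic_repr F gT <[a]> a 1%g 1 1 (zeta ^+ i)%:M 1.
- by rewrite cycle1 mul1g.
- by rewrite cycle1; apply/setIidPl/sub1G.
- by rewrite invg1 mul1g mulg1 expg1.
- by rewrite ord_a scalX exprAC (prim_expr_order zeta_prim) expr1n.
- by rewrite expr1n.
- by rewrite mulr1 mul1r expr1.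
by exists chi.
Qed.

End Holomorph.

(** * The four statements for the holomorph *)

Theorem theorem6p0p1 (R : realType) (p n r : nat) (gT : finGroupType)
    (G : {group gT}) (a b : gT) (zeta : R[i])
    (p_prime : prime p) (p_odd : odd p) (n_gt0 : (0 < n)%N)
    (G_Hol : G \isog Hol (Zp (p ^ n)))
    (r_order : (p ^ n.-1 * p.-1).-primitive_root (r%:R : 'Z_(p ^ n)))
    (G_gen : G :=: <<[set a; b]>>)
    (a_rel : (a ^+ (p ^ n) = 1)%g)
    (b_rel : (b ^+ (p ^ n.-1 * p.-1) = 1)%g)
    (ab_rel : (b^-1 * a * b = a ^+ r)%g)
    (zeta_prim : (p ^ n).-primitive_root zeta) :
  exists (chi : nat -> mx_representation R[i] <[a]> 1)
         (rho0 : R[i] -> mx_representation R[i] G 1)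
         (rho : forall k : nat,
            R[i] -> mx_representation R[i] G (totient (p ^ k))),
  let O k := conj_orbit G (chi (if k == 0 then 0 else p ^ (n - k))%N) in
  let corr (psi : mx_representation R[i] <[a]> 1) :=
    @little_group _ _ G <[a]> <[b]> psi in
  [/\ forall i : nat, (i < p ^ n)%N -> chi i a = (zeta ^+ i)%:M,
      forall w : R[i], (p ^ n.-1 * p.-1).-unity_root w ->
        rho0 w a = 1%:M /\ rho0 w b = w%:M
    & forall (k : nat) (w : R[i]), (1 <= k <= n)%N ->
        (p ^ (n - k)).-unity_root w ->
        rho k w a = rho_a p n r zeta k /\ rho k w b = rho_b p k w]
  /\
  [/\ (* 1 *)
      exactly (totient (p ^ n))
        (fun V : representation R[i] G => rdegree V = 1%N)
      /\ they_are (fun V : representation R[i] G => rdegree V = 1%N)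
           (fun w => (p ^ n.-1 * p.-1).-unity_root w)
           (fun w => Representation (rho0 w)),
      (* 2; psi is the representative chosen in the orbit *)
      forall k : nat, (1 <= k <= n)%N ->
      forall psi : mx_representation R[i] <[a]> 1, O k psi ->
        [/\ forall V, corr psi V ->
              mx_irreducible V /\ rdegree V = totient (p ^ k),
            exactly (p ^ (n - k)) (corr psi)
          & they_are (corr psi)
              (fun w => (p ^ (n - k)).-unity_root w)
              (fun w => Representation (rho k w))],
      (* 3 *)
      exactly (\sum_(0 <= i < n.+1) p ^ i - p ^ n.-1)%N
        (fun V : representation R[i] G => mx_irreducible V)
    & (* 4 *)
      forall psi : mx_representation R[i] <[a]> 1, O n psi ->
      exists V : representation R[i] G,
        [/\ corr psi V,
            forall W, corr psi W -> mx_rsim W V,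
            mx_irreducible V /\ rdegree V = totient (p ^ n),
            mx_faithful V
          & forall W : representation R[i] G,
              mx_irreducible W -> mx_faithful W -> mx_rsim W V]].
Proof.
have pn_gt1 : (1 < p ^ n)%N by rewrite -(exp1n n) ltn_exp2r // prime_gt1.
have eE : (p ^ n.-1 * p.-1)%N = totient (p ^ n) by rewrite totient_pfactor // mulnC.
rewrite eE in r_order b_rel *.
have cardG : #|G| = (p ^ n * totient (p ^ n))%N.
  by rewrite (card_isog G_Hol) card_Hol_Zp // ltnW.
have e_gt0 : (0 < totient (p ^ n))%N by rewrite totient_gt0 ltnW.
have G_def := metacyclic_mul G_gen ab_rel.
have [ord_a ord_b G_TI] :=
  metacyclic_orders (ltnW pn_gt1) e_gt0 G_gen cardG a_rel b_rel ab_rel.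
pose q k := scalar_order p n k.
pose rho k w := sval (@rho_total R[i] p n r gT G a b zeta p_prime n_gt0 r_order
  zeta_prim G_def G_TI ab_rel ord_a ord_b k w).
have rhoP k w : (k <= n)%N -> w ^+ q k = 1 -> is_rho n r a b zeta w (rho k w).
  by rewrite /rho; case: rho_total.
pose chi i := sval (@cycle_character R[i] p n gT a zeta zeta_prim ord_a i).
have chiP i : chi i a = (zeta ^+ i)%:M by rewrite /chi; case: cycle_character.
(* A single primitive root suffices: its power of exponent [totient (p ^ k)] is primitive of order
   [q k]. *)
have [y y_prim] := closed_field_prim_root R[i] e_gt0.
have z_prim k : (k <= n)%N -> (q k).-primitive_root (y ^+ totient (p ^ k)).
  move=> le_kn; have := exp_prim_root y_prim (totient (p ^ k)).
  by rewrite (gcdn_idPl (dvdn_totient_pfactor p_prime n_gt0 r_order le_kn)).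
have q_gt0 k (le_kn : (k <= n)%N) : (0 < q k)%N.
  exact: (scalar_order_gt0 p_prime n_gt0 r_order le_kn).
have qE k : (0 < k <= n)%N -> q k = (p ^ (n - k))%N by apply: scalar_orderE.
have q0 : q 0 = totient (p ^ n) := scalar_order0 p n.
have unityE m (w : R[i]) : m.-unity_root w <-> w ^+ m = 1.
  by rewrite unity_rootE; split=> [/eqP|->].
have rho_irr k w : (k <= n)%N -> w ^+ q k = 1 -> mx_irreducible (rho k w).
  move=> le_kn w1.
  apply: (rho_irreducible p_prime n_gt0 r_order zeta_prim G_def le_kn _
    (rhoP k w le_kn w1)).
  exact: (scalar_order_neq0 p_prime n_gt0 r_order le_kn w1).
have irr_rho (V : representation R[i] G) : mx_irreducible V ->
    exists k w, [/\ (k <= n)%N, w ^+ q k = 1 & mx_rsim V (rho k w)].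
  case/(irr_rsim_rho p_prime n_gt0 r_order zeta_prim G_def ab_rel ord_a ord_b).
  move=> k [w [le_kn w1 sim]]; exists k, w; split=> //.
  by apply: mx_rsim_sym; apply: sim; apply: rhoP.
have lin_rho (V : representation R[i] G) : rdegree V = 1%N ->
    exists2 w, w ^+ q 0 = 1 & mx_rsim V (rho 0 w).
  move=> V1; have /irr_rho[k [w [le_kn w1 sim]]] : mx_irreducible V.
    exact/mx_abs_irrW/linear_mx_abs_irr.
  have k0 : k = 0%N.
    apply: (totient_pfactor_inj p_prime p_odd).
    by rewrite -(mxrank_rsim sim) V1.
  by subst k; exists w.
(* The degree [totient (p ^ 0)] computes to 1, so the linear representations are the case [k = 0] of
   the same family. *)
exists chi, (fun w => rho 0 w), rho => O corr.
have orbit_value k psi : (1 <= k <= n)%N -> O k psi ->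
    exists2 s, coprime p s & psi a = (zeta ^+ (s * p ^ (n - k)))%:M.
  case/andP=> k_gt0 le_kn; rewrite /O gtn_eqF //.
  exact: (conj_orbit_value p_prime n_gt0 r_order G_def ab_rel le_kn (chiP _)).
have corr_sim k psi : (1 <= k <= n)%N -> O k psi -> forall V, corr psi V ->
    exists2 w, w ^+ q k = 1 & mx_rsim V (rho k w).
  move=> k_int /(orbit_value _ _ k_int)[s co_s psi_a] V; have /andP[_ le_kn] := k_int.
  case/(little_group_rsim p_prime n_gt0 r_order zeta_prim G_def ab_rel ord_b le_kn
    co_s psi_a)=> w w1 sim.
  by exists w => //; apply/mx_rsim_sym/sim/rhoP.
have corr_rho k psi : (1 <= k <= n)%N -> O k psi -> forall w, w ^+ q k = 1 ->
    corr psi (Representation (rho k w)).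
  move=> k_int /(orbit_value _ _ k_int)[s co_s psi_a] w w1; have /andP[_ le_kn] := k_int.
  apply: (little_group_rho p_prime n_gt0 r_order zeta_prim G_def ab_rel le_kn co_s psi_a
    _ (rhoP k w le_kn w1)).
  exact: (scalar_order_neq0 p_prime n_gt0 r_order le_kn w1).
split.
  split=> [i _|w|k w /andP[k_gt0 le_kn]]; first exact: chiP.
    rewrite -q0 => /unityE w1; have [-> ->] := rhoP 0 w (leq0n n) w1.
    split; apply/matrixP=> i j; rewrite (ord1 i) (ord1 j) !mxE //=.
    by rewrite subn0 exprM exprAC (prim_expr_order zeta_prim) expr1n.
  rewrite -qE ?k_gt0 // => /unityE w1.
  exact: rhoP.
split.
- split.
    rewrite -q0; apply: (exactly_rho p_prime G_def (leq0n n) (z_prim 0 (leq0n n))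
      (fun w => rhoP 0 w (leq0n n))) lin_rho.
    by [].
  split=> [//|V]; rewrite -q0.
  by case/lin_rho=> w /unityE; exists w.
- move=> k k_int psi Opsi; have /andP[_ le_kn] := k_int; split.
  + move=> V /(corr_sim k psi k_int Opsi)[w w1 sim]; split; last exact: mxrank_rsim sim.
    exact: mx_rsim_irr (mx_rsim_sym sim) (rho_irr _ _ le_kn w1).
  + rewrite -qE //; exact: (exactly_rho p_prime G_def le_kn (z_prim k le_kn)
      (fun w => rhoP k w le_kn) (corr_rho k psi k_int Opsi) (corr_sim k psi k_int Opsi)).
  rewrite -qE //; split=> [w /unityE|V]; first exact: corr_rho.
  by case/(corr_sim k psi k_int Opsi)=> w /unityE; exists w.
- by apply: (exactly_irr p_prime n_gt0 r_order zeta_prim G_def ab_rel ord_a ord_b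
    p_odd z_prim rhoP).
move=> psi Opsi; have n_int : (1 <= n <= n)%N by rewrite n_gt0 leqnn.
(* For [k = n] the only admissible scalar is [w = 1], hence uniqueness. *)
have qn : q n = 1%N by rewrite qE // subnn.
have w1 : (1 : R[i]) ^+ q n = 1 by rewrite expr1n.
have rho1 := rhoP n 1 (leqnn n) w1.
exists (Representation (rho n 1)); split.
- exact: corr_rho.
- by move=> W /(corr_sim n psi n_int Opsi)[w]; rewrite qn expr1 => ->.
- by split=> //; apply: rho_irr.
- exact: (rho_faithful p_prime n_gt0 r_order zeta_prim G_def ab_rel ord_a ord_b rho1).
move=> W /irr_rho[k [w [le_kn wq sim]]] fW.
have kn : k = n.
  apply: (faithful_rho p_prime n_gt0 zeta_prim G_def ord_a le_kn (rhoP k w le_kn wq)).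
  by rewrite -(mx_rsim_faithful sim).
by subst k; move: wq sim; rewrite qn expr1 => ->.
Qed.
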